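(* For every $a\in\mathbb{D}$, the sequence $((z-a)^n)_{n\in\mathbb{N}}$ is complete and conjugate-orthogonal in $H^2(\mathbb{D})$, and it is not an orthonormal basis of $H^2(\mathbb{D})$ when $a\neq 0$.
   Context: $\mathbb{D}$ is the open unit disk in $\mathbb{C}$ and $\mathbb{N}=\{0,1,2,\dots\}$. $H^2(\mathbb{D})$ is the Hardy space of analytic functions $f(z)=\sum_{n\ge 0}\widehat f(n)z^n$ on $\mathbb{D}$ with $\sum_n|\widehat f(n)|^2<\infty$, a Hilbert space with inner product $\langle f,g\rangle=\sum_n\widehat f(n)\overline{\widehat g(n)}$. A conjugation on a Hilbert space $\mathcal{H}$ is a conjugate-linear map $J:\mathcal{H}\to\mathcal{H}$ with $\langle Jf,Jg\rangle=\langle g,f\rangle$ for all $f,g\in\mathcal{H}$ and $J^2=I$. A sequence $(f_n)_{n\in\mathbb{N}}$ in $\mathcal{H}$ is conjugate-orthogonal if there is a conjugation $J$ on $\mathcal{H}$ with $\langle Jf_n,f_m\rangle=0$ for all $n\ne m$. It is complete if its linear span is dense in $\mathcal{H}$. *)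

(* Defs.v *)
From HB Require Import structures.
From mathcomp Require Import all_boot all_order all_algebra sesquilinear.
From mathcomp Require Import complex.
From mathcomp Require Import all_classical all_reals all_analysis.
From mathcomp Require Import ring lra.
Set Implicit Arguments.
Unset Strict Implicit.
Unset Printing Implicit Defensive.
Import Order.TTheory GRing.Theory Num.Theory.
Import numFieldNormedType.Exports.
Import ComplexField.Normc.
Local Open Scope classical_set_scope.
Local Open Scope ring_scope.
Local Open Scope complex_scope.

(* {dot V for Num.conj}: positive definite Hermitian forms, linear in the first
   argument and conjugate-linear in the second one. *)
Section InnerProduct.
Variables (K : numClosedFieldType) (V : lmodType K).
Variable dot : {dot V for @Num.conj K}.

Definition conjugation (J : V -> V) : Prop :=
  [/\ forall (c : K) (f g : V), J (c *: f + g) = (c^*)%R *: J f + J g,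
      forall f g : V, dot (J f) (J g) = dot g f
    & forall f : V, J (J f) = f].

Definition conjugate_orthogonal (f : nat -> V) : Prop :=
  exists2 J : V -> V, conjugation J &
    forall n m : nat, n <> m -> dot (J (f n)) (f m) = 0.

Definition lin_span (f : nat -> V) : set V :=
  [set g | exists (N : nat) (c : 'I_N -> K), g = \sum_(k < N) c k *: f k].

Definition dense_in_norm (A : set V) : Prop :=
  forall (g : V) (e : K), 0 < e ->
    exists2 h : V, A h & sqrtC (dot (g - h) (g - h)) < e.

Definition complete_seq (f : nat -> V) : Prop := dense_in_norm (lin_span f).

Definition orthonormal_basis (f : nat -> V) : Prop :=
  (forall n m : nat, dot (f n) (f m) = (n == m)%:R) /\ complete_seq f.

End InnerProduct.

Section Hardy.
Variable R : realType.

(* Points of the open unit disk form a type, so that Leibniz equality of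
   functions on [disk] is equality on the disk. *)
Definition disk := {z : R[i] | `|z| < 1}.

Definition square_summable (c : nat -> R[i]) : Prop :=
  (\sum_(n <oo) (normc (c n) ^+ 2)%:E < +oo)%E.

Definition taylor_expansion (c : nat -> R[i]) (f : disk -> R[i]) : Prop :=
  forall z : disk,
    series (fun n => c n * sval z ^+ n : R[i]^o) @ \oo --> (f z : R[i]^o).

Definition hardy2 : {pred disk -> R[i]} :=
  mem [set f | exists2 c : nat -> R[i],
                 square_summable c & taylor_expansion c f].

Lemma norm_normc (x : R[i]) : (`|x| = (normc x)%:C)%R.
Proof. by case: x. Qed.

Lemma normc_ge0 (x : R[i]) : 0 <= normc x.
Proof. by case: x => a b; exact: sqrtr_ge0. Qed.

Lemma normcD (x y : R[i]) : normc (x + y) <= normc x + normc y.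
Proof. exact: le_normcD. Qed.

Lemma square_summable0 : square_summable (fun=> 0).
Proof.
rewrite /square_summable eseries0 ?ltry// => n _ _.
by rewrite normc0 expr0n.
Qed.

Lemma square_summableD (a : R[i]) (c d : nat -> R[i]) :
  square_summable c -> square_summable d ->
  square_summable (fun n => a * c n + d n).
Proof.
move=> sc sd.
have p0 (u : nat -> R[i]) (n : nat) : (0 <= (normc (u n) ^+ 2)%:E)%E.
  by rewrite lee_fin sqr_ge0.
pose k := (2 * normc a ^+ 2 : R).
apply: (@le_lt_trans _ _ (\sum_(n <oo) (k%:E * (normc (c n) ^+ 2)%:E +
                                   2%:E * (normc (d n) ^+ 2)%:E))%E).
  apply: lee_nneseries => [n _ _|n _]; first by rewrite lee_fin sqr_ge0.
  rewrite -!EFinM -EFinD lee_fin.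
  apply: (@le_trans _ _ ((normc a * normc (c n) + normc (d n)) ^+ 2)).
    rewrite ler_sqr ?nnegrE ?normc_ge0 ?addr_ge0 ?mulr_ge0 ?normc_ge0//.
    by rewrite -normcM normcD.
  rewrite /k -subr_ge0; set x := normc _; set y := normc _; set z := normc _.
  rewrite [leRHS](_ : _ = (x * y - z) ^+ 2) ?sqr_ge0//.
  ring.
have k0 : 0 <= k by rewrite mulr_ge0 ?sqr_ge0.
rewrite nneseriesD; last 2 first.
- by move=> n _ _; rewrite mule_ge0.
- by move=> n _ _; rewrite mule_ge0.
by rewrite !nneseriesZl// lte_add_pinfty// lte_mul_pinfty.
Qed.

Lemma taylor_expansionD (a : R[i]) c d (f g : disk -> R[i]) :
  taylor_expansion c f -> taylor_expansion d g ->
  taylor_expansion (fun n => a * c n + d n) (a *: f + g).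
Proof.
move=> cf dg z.
pose u n : R[i]^o := c n * sval z ^+ n.
pose v n : R[i]^o := d n * sval z ^+ n.
rewrite (_ : series _ = fun n => a *: series u n + series v n).
  by apply: cvgD; [apply: cvgZr; exact: cf|exact: dg].
apply/funext => n; rewrite /series/= scaler_sumr -big_split/=.
by apply: eq_bigr => i _; rewrite mulrDl -mulrA.
Qed.

Lemma hardy2_submod_closed : submod_closed hardy2.
Proof.
split.
  rewrite inE; exists (fun=> 0); first exact: square_summable0.
  move=> z; rewrite (_ : series _ = cst 0); first exact: cvg_cst.
  by apply/funext => n; rewrite /series/= big1// => i _; rewrite mul0r.
move=> a f g /set_mem[c sc cf] /set_mem[d sd dg]; apply/mem_set.
exists (fun n => a * c n + d n); first exact: square_summableD.
exact: taylor_expansionD.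
Qed.

HB.instance Definition _ :=
  GRing.isSubmodClosed.Build _ _ hardy2 hardy2_submod_closed.

Record H2 := mkH2 { H2fun :> disk -> R[i]; H2funP : H2fun \in hardy2 }.

HB.instance Definition _ := [isSub for H2fun].
HB.instance Definition _ := [Choice of H2 by <:].
HB.instance Definition _ := [SubChoice_isSubLmodule of H2 by <:].

Lemma H2_taylor (f : H2) :
  exists c, square_summable c /\ taylor_expansion c f.
Proof. by have := H2funP f; rewrite inE => -[c ? ?]; exists c. Qed.

(* Picked by choice, but determined by [f]: see [H2coef_unique]. *)
Definition H2coef (f : H2) : nat -> R[i] := sval (cid (H2_taylor f)).

Lemma H2coefP (f : H2) :
  square_summable (H2coef f) /\ taylor_expansion (H2coef f) f.
Proof. exact: svalP (cid (H2_taylor f)). Qed.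

Lemma normc_le_ReIm (x : R[i]) : normc x <= `|complex.Re x| + `|complex.Im x|.
Proof.
case: x => a b /=.
have h : 0 <= `|a| + `|b| by rewrite addr_ge0.
rewrite -(ger0_norm h) -sqrtr_sqr ler_wsqrtr// sqrrD !real_normK ?num_real//.
by rewrite addrAC lerDl mulrn_wge0// mulr_ge0.
Qed.

Lemma Re_le_normc (x : R[i]) : `|complex.Re x| <= normc x.
Proof.
by case: x => a b /=; rewrite -sqrtr_sqr ler_wsqrtr// lerDl sqr_ge0.
Qed.

Lemma Im_le_normc (x : R[i]) : `|complex.Im x| <= normc x.
Proof.
by case: x => a b /=; rewrite -sqrtr_sqr ler_wsqrtr// lerDr sqr_ge0.
Qed.

Lemma cvg_complexP (u : nat -> R[i]^o) (l : R[i]^o) :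
  (u @ \oo --> l) <-> (fun n => normc (l - u n)) @ \oo --> (0 : R).
Proof.
split => [/cvgrPdist_lt ul|/cvgrPdist_lt ul]; apply/cvgrPdist_lt.
  move=> e e0; have e0' : 0 < e%:C :> R[i] by rewrite ltcR.
  near=> n; rewrite sub0r normrN ger0_norm ?normc_ge0//.
  by rewrite -ltcR -norm_normc; near: n; exact: ul.
move=> [e i]; rewrite ltcE/= => /andP[/eqP -> e0].
near=> n; have : `|0 - normc (l - u n)| < e by near: n; exact: ul.
by rewrite sub0r normrN ger0_norm ?normc_ge0// norm_normc ltcR.
Unshelve. all: by end_near. Qed.

Lemma cvg_complex (u : nat -> R[i]^o) (l : R[i]^o) :
  (fun n => complex.Re (u n)) @ \oo --> complex.Re l ->
  (fun n => complex.Im (u n)) @ \oo --> complex.Im l ->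
  u @ \oo --> l.
Proof.
move=> /cvgrPdist_lt ra /cvgrPdist_lt rb; apply/cvg_complexP/cvgrPdist_lt => e e0.
have e20 : 0 < e / 2 by rewrite divr_gt0.
near=> n; rewrite sub0r normrN ger0_norm ?normc_ge0//.
apply: (le_lt_trans (normc_le_ReIm _)); rewrite (splitr e) ltrD//.
  rewrite raddfB/=; near: n; exact: ra.
by rewrite raddfB/=; near: n; exact: rb.
Unshelve. all: by end_near. Qed.

Lemma cvg_conjc (u : nat -> R[i]^o) (l : R[i]^o) :
  u @ \oo --> l -> (fun n => (u n)^*%R : R[i]^o) @ \oo --> ((l^*)%R : R[i]^o).
Proof.
move/cvg_complexP => ul; apply/cvg_complexP.
suff -> : (fun n => normc (l^* - (u n)^*)%R) = (fun n => normc (l - u n)) by [].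
by apply/funext => n; rewrite -rmorphB; case: (l - u n) => a b /=; rewrite sqrrN.
Qed.

Lemma square_summable_cvg (c : nat -> R[i]) : square_summable c ->
  cvgn (series (fun n => normc (c n) ^+ 2)).
Proof.
move=> sc; apply: nondecreasing_is_cvgn.
  apply/nondecreasing_seqP => n; rewrite /series/= big_nat_recr//=.
  by rewrite lerDl sqr_ge0.
have p0 n : (0 <= (normc (c n) ^+ 2)%:E)%E by rewrite lee_fin sqr_ge0.
exists (fine (\sum_(n <oo) (normc (c n) ^+ 2)%:E)%E) => _ [n _ <-].
rewrite -lee_fin fineK; last by rewrite ge0_fin_numE// nneseries_ge0.
by rewrite /series/= -sumEFin nneseries_lim_ge.
Qed.

Lemma cvg_h2dot (c d : nat -> R[i]) : square_summable c -> square_summable d ->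
  cvgn (series (fun n => c n * (d n)^*%R : R[i]^o)).
Proof.
move=> /square_summable_cvg sc /square_summable_cvg sd.
pose m n := normc (c n) ^+ 2 + normc (d n) ^+ 2.
have sm : cvgn (series m).
  have -> : series m = fun n => series (fun n => normc (c n) ^+ 2) n +
                                  series (fun n => normc (d n) ^+ 2) n.
    by apply/funext => n; rewrite /series/= -big_split.
  exact: is_cvgD.
have mb n : normc (c n * (d n)^*%R) <= m n.
  rewrite normcM (_ : normc (d n)^*%R = normc (d n)); last first.
    by case: (d n) => a b /=; rewrite sqrrN.
  rewrite /m -subr_ge0.
  have x0 := normc_ge0 (c n); have y0 := normc_ge0 (d n).
  by move: (normc (c n)) (normc (d n)) x0 y0 => x y x0 y0; nra.
have m0 n : 0 <= m n by rewrite addr_ge0// sqr_ge0.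
pose u n := c n * (d n)^*%R.
have cr : cvgn (series (fun n => complex.Re (u n))).
  apply: normed_cvg; apply: (series_le_cvg _ _ _ sm) => //= n.
  by rewrite (le_trans (Re_le_normc _))//; exact: mb.
have ci : cvgn (series (fun n => complex.Im (u n))).
  apply: normed_cvg; apply: (series_le_cvg _ _ _ sm) => //= n.
  by rewrite (le_trans (Im_le_normc _))//; exact: mb.
apply/cvg_ex; exists (limn (series (fun n => complex.Re (u n))) +i*
                      limn (series (fun n => complex.Im (u n)))).
apply: cvg_complex => /=.
  rewrite (_ : (fun n => _) = series (fun n => complex.Re (u n)))//.
  by apply/funext => n; rewrite /series/= raddf_sum.
rewrite (_ : (fun n => _) = series (fun n => complex.Im (u n)))//.
by apply/funext => n; rewrite /series/= raddf_sum.
Qed.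


Lemma square_summable_bounded (c : nat -> R[i]) : square_summable c ->
  exists2 M : R, 0 <= M & forall n, normc (c n) <= M.
Proof.
move=> /square_summable_cvg sc.
have nd : nondecreasing_seq (series (fun n => normc (c n) ^+ 2)).
  apply/nondecreasing_seqP => n; rewrite /series/= big_nat_recr//=.
  by rewrite lerDl sqr_ge0.
exists (limn (series (fun n => normc (c n) ^+ 2)) + 1).
  apply: addr_ge0 => //; apply: limr_ge => //.
  by apply: nearW => n; rewrite /series/= sumr_ge0// => i _; rewrite sqr_ge0.
move=> n; have := nondecreasing_cvgn_le nd sc n.+1.
rewrite /series/= big_nat_recr//=.
have : 0 <= \sum_(0 <= i < n) normc (c i) ^+ 2.
  by rewrite sumr_ge0// => i _; rewrite sqr_ge0.
by move: (limn _) (\sum_(_ <= _ < _) _) (normc _) => L S x; nra.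
Qed.

Lemma taylor_expansion_eq0 (c : nat -> R[i]) :
  square_summable c -> taylor_expansion c 0 -> forall n, c n = 0.
Proof.
move=> sc c0; have [M M0 cM] := square_summable_bounded sc.
elim/ltn_ind => N IH; apply: eq0_normc; apply/eqP; rewrite -[_ == _]negbK.
apply/negP => cN0.
have {cN0} cN : 0 < normc (c N) by rewrite lt_def cN0 normc_ge0.
pose D := 2 * (1 + 2 * M) + 2 * normc (c N).
have D0 : 0 < D by rewrite /D; lra.
pose r := normc (c N) / D.
have r0 : 0 < r by rewrite divr_gt0.
have r2 : r <= 2^-1 by rewrite ler_pdivrMr// /D; lra.
have zr : `|r%:C : R[i]| < 1.
  by rewrite norm_normc ltcR /= expr0n addr0 sqrtr_sqr gtr0_norm//; lra.
pose z : disk := exist _ r%:C zr.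
pose u i := c i * r%:C ^+ i.
have nr i : normc (r%:C ^+ i) = r ^+ i.
  by rewrite -rmorphXn/= expr0n addr0 sqrtr_sqr ger0_norm// exprn_ge0// ltW.
have tail k m : normc (\sum_(m <= i < m + k) u i) <= 2 * M * r ^+ m.
  elim: k m => [|k IHk] m.
    by rewrite addn0 big_geq// normc0 !mulr_ge0// exprn_ge0// ltW.
  rewrite big_ltn ?addnS ?ltnS ?leq_addr//.
  apply: (le_trans (normcD _ _)); rewrite normcM nr.
  have := IHk m.+1; rewrite addSn exprS => Hk.
  have rm : 0 <= r ^+ m by rewrite exprn_ge0// ltW.
  apply: (@le_trans _ _ (M * r ^+ m + 2 * M * (r * r ^+ m))).
    by rewrite lerD// ler_wpM2r.
  rewrite -subr_ge0.
  have -> : 2 * M * r ^+ m - (M * r ^+ m + 2 * M * (r * r ^+ m)) =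
            M * r ^+ m * (1 - 2 * r) by ring.
  by rewrite !mulr_ge0//; lra.
have /cvg_complexP/cvgrPdist_lt uz := c0 z.
have rN0 : 0 < r ^+ N.+1 by rewrite exprn_gt0.
have [K _ HK] := uz _ rN0.
have := HK (K + N.+1)%N; rewrite /= leq_addr => /(_ isT).
rewrite sub0r normrN ger0_norm ?normc_ge0// sub0r.
rewrite /series/= (@big_cat_nat _ _ _ N)//=; last by rewrite addnS ltnW// ltnS leq_addl.
rewrite big_nat big1; last by move=> i /andP[_ iN]; rewrite IH// mul0r.
rewrite add0r big_ltn; last by rewrite addnS ltnS leq_addl.
rewrite -/(u _) (addnC K).
set T := \sum_(_ <= _ < _) _.
have Tb : normc T <= 2 * M * r ^+ N.+1 by exact: tail.
move=> H.
have : normc (u N) <= normc (- (u N + T)) + normc T.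
  rewrite normcN -(normcN T).
  by rewrite (le_trans _ (normcD _ _))// addrK.
rewrite normcM nr.
have -> : normc (c N) = r * D by rewrite /r divfK// gt_eqF.
rewrite exprS in Tb H *.
have rm : 0 < r ^+ N by rewrite exprn_gt0.
move=> H2.
have {H2 H Tb} H3 := le_trans H2 (lerD (ltW H) Tb).
have : r * r ^+ N * D <= r * r ^+ N * (1 + 2 * M).
  by apply: le_trans (_ : r * D * r ^+ N <= _); [rewrite mulrAC|apply: (le_trans H3); lra].
rewrite (ler_pM2l (mulr_gt0 r0 rm)) /D; lra.
Qed.

Lemma taylor_expansion_unique (c d : nat -> R[i]) (f : disk -> R[i]) :
  square_summable c -> square_summable d ->
  taylor_expansion c f -> taylor_expansion d f -> c =1 d.
Proof.
move=> sc sd cf df n; apply/esym/eqP; rewrite -subr_eq0 addrC -mulN1r; apply/eqP.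
apply: (@taylor_expansion_eq0 (fun n => -1 * c n + d n)).
  exact: square_summableD.
by have := @taylor_expansionD (-1) _ _ _ _ cf df; rewrite scaleN1r addNr.
Qed.

Lemma H2coef_unique (f : H2) c :
  square_summable c -> taylor_expansion c f -> H2coef f =1 c.
Proof.
have [sf tf] := H2coefP f => sc tc.
exact: (taylor_expansion_unique sf sc tf tc).
Qed.

Lemma H2coefD (a : R[i]) (f g : H2) n :
  H2coef (a *: f + g) n = a * H2coef f n + H2coef g n.
Proof.
have [sf tf] := H2coefP f; have [sg tg] := H2coefP g.
apply: (@H2coef_unique _ (fun n => a * H2coef f n + H2coef g n)).
  exact: square_summableD.
exact: (taylor_expansionD tf tg).
Qed.

(* The limit in [limn] exists: see [cvg_H2dot]. *)
Definition H2dot (f g : H2) : R[i] :=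
  limn (series (fun n => H2coef f n * (H2coef g n)^*%R : R[i]^o)).

Lemma cvg_H2dot (f g : H2) :
  series (fun n => H2coef f n * (H2coef g n)^*%R : R[i]^o) @ \oo -->
  (H2dot f g : R[i]^o).
Proof. exact: cvg_h2dot (H2coefP f).1 (H2coefP g).1. Qed.

Lemma H2dot_eq (f g : H2) (l : R[i]^o) :
  series (fun n => H2coef f n * (H2coef g n)^*%R : R[i]^o) @ \oo --> l ->
  H2dot f g = l.
Proof. exact: (@cvg_lim _ (@norm_hausdorff _ _)). Qed.

Lemma H2dot_herm (f g : H2) : H2dot f g = (-1) ^+ false * (H2dot g f)^*%R.
Proof.
rewrite expr0 mul1r; apply: H2dot_eq.
pose u n : R[i]^o := H2coef g n * (H2coef f n)^*%R.
rewrite (_ : series _ = fun n => (series u n)^*%R : R[i]^o).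
  exact: cvg_conjc (@cvg_H2dot g f).
apply/funext => n; rewrite /series/= rmorph_sum/=.
by apply: eq_bigr => i _; rewrite rmorphM/= conjCK mulrC.
Qed.

Lemma H2dot_linearl (g : H2) :
  GRing.linear_for ( *%R : R[i] -> R[i] -> R[i]) (H2dot^~ g).
Proof.
move=> a f1 f2; apply: H2dot_eq.
pose u f n : R[i]^o := H2coef f n * (H2coef g n)^*%R.
rewrite (_ : series _ = fun n => a *: series (u f1) n + series (u f2) n).
  by apply: cvgD; [apply: cvgZr|]; exact: cvg_H2dot.
apply/funext => n; rewrite /series/= scaler_sumr -big_split/=.
by apply: eq_bigr => i _; rewrite H2coefD mulrDl -mulrA.
Qed.

Lemma H2dot_linearr (f : H2) :
  GRing.linear_for (@Num.conj R[i] \; *%R) (H2dot f).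
Proof.
have hC g : H2dot f g = (H2dot g f)^*%R by rewrite H2dot_herm expr0 mul1r.
move=> a g1 g2; rewrite hC H2dot_linearl rmorphD rmorphM.
by rewrite (hC g1) (hC g2).
Qed.

Lemma H2dot_gt0 (f : H2) : f != 0 -> 0 < H2dot f f.
Proof.
move=> f0.
have [N cN] : exists n, H2coef f n != 0.
  apply/not_existsP => c0; move/negP: f0; apply; apply/eqP/val_inj/funext => z/=.
  have [_ /(_ z) tf] := H2coefP f.
  apply: (@cvg_unique _ (@norm_hausdorff _ _) _ _ _ _ tf).
  rewrite (_ : series _ = cst 0); first exact: cvg_cst.
  apply/funext => n; rewrite /series/= big1// => i _.
  by have /negP := c0 i; rewrite negbK => /eqP ->; rewrite mul0r.
have sc := square_summable_cvg (H2coefP f).1.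
have -> : H2dot f f = (limn (series (fun n => normc (H2coef f n) ^+ 2)))%:C.
  apply: H2dot_eq; apply: cvg_complex => /=.
    rewrite (_ : (fun n => _) = series (fun n => normc (H2coef f n) ^+ 2))//.
    apply/funext => n; rewrite /series/= raddf_sum; apply: eq_bigr => i _.
    by rewrite -normCK norm_normc -rmorphXn.
  rewrite (_ : (fun n => _) = cst 0); first exact: cvg_cst.
  apply/funext => n; rewrite /series/= raddf_sum big1// => i _.
  by rewrite -normCK norm_normc -rmorphXn.
rewrite ltcR; have nd : nondecreasing_seq (series (fun n => normc (H2coef f n) ^+ 2)).
  apply/nondecreasing_seqP => n; rewrite /series/= big_nat_recr//=.
  by rewrite lerDl sqr_ge0.
apply: lt_le_trans (nondecreasing_cvgn_le nd sc N.+1).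
rewrite /series/= big_nat_recr//= ltr_wpDl//.
  by rewrite sumr_ge0// => i _; rewrite sqr_ge0.
rewrite exprn_gt0// lt_def normc_ge0 andbT.
by apply: contra cN => /eqP/eq0_normc ->.
Qed.

HB.instance Definition _ := bilinear_isBilinear.Build R[i] H2 H2 R[i]
  *%R (@Num.conj R[i] \; *%R) H2dot (H2dot_linearl, H2dot_linearr).
HB.instance Definition _ := isHermitianSesquilinear.Build R[i] H2 false
  (@Num.conj R[i]) H2dot H2dot_herm.
HB.instance Definition _ := isDotProduct.Build R[i] H2 H2dot H2dot_gt0.

Lemma poly_hardy2 (p : {poly R[i]}) : (fun z : disk => p.[sval z]) \in hardy2.
Proof.
apply/mem_set; exists (fun n => p`_n).
  rewrite /square_summable (nneseries_split _ (size p)); last first.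
    by move=> k _; rewrite lee_fin sqr_ge0.
  rewrite eseries0; last first.
    by move=> i hi _; rewrite nth_default// normc0 expr0n.
  by rewrite adde0 sumEFin ltry.
move=> z; apply: cvg_near_cst; exists (size p) => // n /= hn.
rewrite /series/= horner_coef (@big_cat_nat _ _ _ (size p))//= big_mkord.
rewrite [X in _ + X](_ : _ = 0) ?addr0// big_nat big1// => i /andP[hi _].
by rewrite nth_default// mul0r.
Qed.

Lemma shifted_power_hardy2 (a : R[i]) (n : nat) :
  (fun z : disk => (sval z - a) ^+ n) \in hardy2.
Proof.
rewrite (_ : (fun z => _) = fun z : disk => (('X - a%:P) ^+ n).[sval z]).
  exact: poly_hardy2.
by apply/funext => z; rewrite !hornerE.
Qed.

Definition shifted_power (a : R[i]) (n : nat) : H2 :=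
  mkH2 (shifted_power_hardy2 a n).

End Hardy.

(* Main.v *)
Require Import Defs.
From mathcomp Require Import all_boot all_order all_algebra sesquilinear.
From mathcomp Require Import complex.
From mathcomp Require Import all_classical all_reals all_analysis.
From mathcomp Require Import ring.

(** Completeness is elementary: truncating Taylor series shows that polynomials
    are dense, and every polynomial in z is a polynomial in z - a
    ([lin_span_shifted_power]).  The sequence is not orthonormal for a != 0
    because <z - a, 1> = - a.

    The content is the conjugation J.  Let w be a unimodular number with
    w a = a^*, that is, w = a^* / a if a != 0.  The disk automorphism
    psi(z) = w (a - z) / (1 - a^* z) and the weight
    gamma / (1 - a^* z), with gamma = sqrt (1 - |a|^2), give the conjugation
      (J f)(z) = gamma / (1 - a^* z) * (f ((psi(z))^* ))^*.
    It suits the powers of z - a for the following reason.  On the unit circle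
    the bilinear form [f, g] = <f, J g> is, up to a constant, the contour
    integral of f(z) g(M z) / (z - a), where M is the Moebius involution
    z |-> a - c / (z - a), c = (1 - |a|^2) w^*.  So M turns (z - a)^m into
    a multiple of (z - a)^(-m), and [(z - a)^n, (z - a)^m] is the integral of a
    multiple of (z - a)^(n - m - 1), which vanishes unless n = m.

    The proof needs neither integrals nor composition operators: it uses
    the matrix U of J on the monomials, whose generating function
      sum U_(n,k) z^k x^n = gamma / (1 - a^* z - a^* x + w z x)
    says that U is symmetric and obeys the recurrence
      U_(n+1,k+1) = a^* (U_(n+1,k) + U_(n,k+1)) - w U_(n,k).
    The recurrence and the first row, of entries gamma (a^* )^k, yield
    - that its rows are square summable ([next_row_sum]) and form an
      orthonormal sequence u_n ([conj_monomial_orthonormal]), which makes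
      f |-> sum_k <u_k, f> z^k an antilinear contraction J, by the Bessel
      inequality.  As U is symmetric, J exchanges z^n and u_n, so J is an
      involution on a dense subspace, hence everywhere, and a contractive
      involution is isometric ([antilinear_contraction_conjugation]);
    - that [(z - a) p, (z - a) q] = (a^2 - w^* ) [p, q] and [(z - a) p, 1] = 0
      for all polynomials p and q, from which the orthogonality follows by
      induction on the exponents ([form_XsubC_powers]). *)

Set Implicit Arguments.
Unset Strict Implicit.
Unset Printing Implicit Defensive.
Import Order.TTheory GRing.Theory Num.Theory.
Import numFieldNormedType.Exports.
Local Open Scope ring_scope.

(** * Bessel's inequality and conjugations in inner product spaces *)

Section InnerProductSpace.
Variables (K : numClosedFieldType) (V : lmodType K).
Variable dot : {dot V for @Num.conj K}.
Implicit Types (f g h : V) (u : nat -> V) (J : V -> V).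

Lemma dotC f g : dot f g = (dot g f)^*.
Proof. by rewrite (hermC dot) expr0 mul1r. Qed.

Lemma dotZr (c : K) f g : dot f (c *: g) = c^* * dot f g.
Proof. by rewrite linearZr_LR. Qed.

Lemma dotZl (c : K) f g : dot (c *: f) g = c * dot f g.
Proof. by rewrite linearZl_LR. Qed.

Lemma dotDl f g h : dot (f + g) h = dot f h + dot g h.
Proof. by rewrite linearDl. Qed.

Lemma dotDr f g h : dot h (f + g) = dot h f + dot h g.
Proof. by rewrite linearDr. Qed.

Lemma dotNl f h : dot (- f) h = - dot f h.
Proof. by rewrite linearNl. Qed.

Lemma dotNr f h : dot h (- f) = - dot h f.
Proof. by rewrite linearNr. Qed.

Definition dotE := (dotDl, dotDr, dotNl, dotNr, dotZl, dotZr).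

Lemma dot_suml (I : finType) (E : I -> V) g :
  dot (\sum_i E i) g = \sum_i dot (E i) g.
Proof. by rewrite linear_sumlz. Qed.

Lemma dot_sumr (I : finType) (E : I -> V) g :
  dot g (\sum_i E i) = \sum_i dot g (E i).
Proof. by rewrite linear_sumr. Qed.

Definition orthonormal_seq u := forall n m, dot (u n) (u m) = (n == m)%:R.

(** Pythagoras for the orthogonal projection p on the first vectors of u. *)
Lemma dot_sub_proj u g N : orthonormal_seq u ->
  let p := \sum_(k < N) dot g (u k) *: u k in
  dot (g - p) (g - p) = dot g g - \sum_(k < N) `|dot g (u k)| ^+ 2.
Proof.
move=> uo p.
have gp : dot g p = \sum_(k < N) `|dot g (u k)| ^+ 2.
  by rewrite dot_sumr; apply: eq_bigr => k _; rewrite dotZr normCKC.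
have pp : dot p p = dot g p.
  rewrite gp dot_suml; apply: eq_bigr => k _.
  rewrite dotZl dot_sumr (bigD1 k)//= big1 ?addr0 => [|j jk].
    by rewrite dotZr uo eqxx mulr1 normCK.
  by rewrite dotZr uo eq_sym (inj_eq val_inj) (negPf jk) mulr0.
have pg : dot p g = dot g p.
  rewrite dotC gp rmorph_sum/=; apply: eq_bigr => k _.
  by rewrite geC0_conj// exprn_ge0.
by rewrite !dotE pg pp -gp; ring.
Qed.

Lemma bessel u g N : orthonormal_seq u ->
  \sum_(k < N) `|dot (u k) g| ^+ 2 <= dot g g.
Proof.
move=> uo; rewrite -subr_ge0.
have := dnorm_ge0 dot (g - \sum_(k < N) dot g (u k) *: u k).
rewrite dot_sub_proj//.
by under eq_bigr => k _ do rewrite dotC norm_conjC.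
Qed.

(** Polarization: the identity is the norm equality at c f + g, at c = 1 and
    c = 'i. *)
Lemma antilinear_isometry J :
  (forall c f g, J (c *: f + g) = c^* *: J f + J g) ->
  (forall f, dot (J f) (J f) = dot f f) ->
  forall f g, dot (J f) (J g) = dot g f.
Proof.
move=> Jl Jn f g.
have H c : c^* * dot (J f) (J g) + c * dot (J g) (J f) =
           c * dot f g + c^* * dot g f.
  have := Jn (c *: f + g); rewrite Jl !dotE conjCK !Jn => E.
  apply: (@addrI _ (c * c^* * dot f f + dot g g)).
  rewrite [RHS](_ : _ = c * (c^* * dot f f + dot f g) +
                        (c^* * dot g f + dot g g)).
    by rewrite -E; ring.
  by ring.
have H1 := H 1; have Hi := H 'i.
have i0 : ('i : K) != 0 := neq0Ci K.
rewrite conjCi in Hi; rewrite rmorph1 !mul1r in H1.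
have {}Hi : dot (J g) (J f) - dot (J f) (J g) = dot f g - dot g f.
  by apply: (mulfI i0); rewrite !mulrBr -!mulNr addrC Hi.
apply: (@mulfI _ (2 : K)); first by rewrite pnatr_eq0.
have -> : 2 * dot (J f) (J g) = dot (J f) (J g) + dot (J g) (J f) -
                            (dot (J g) (J f) - dot (J f) (J g)) by ring.
by rewrite H1 Hi; ring.
Qed.

(** The map J o J is linear and bounded by 1, so it is the identity because it
    is so on a complete sequence; then |f| = |J (J f)| <= |J f| <= |f|. *)
Lemma antilinear_contraction_conjugation (e : nat -> V) J :
  complete_seq dot e ->
  (forall c f g, J (c *: f + g) = c^* *: J f + J g) ->
  (forall f, dot (J f) (J f) <= dot f f) ->
  (forall n, J (J (e n)) = e n) ->
  conjugation dot J.
Proof.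
move=> ce Jl Jc Je.
have J0 : J 0 = 0.
  have := Jl 0 0 0; rewrite conjC0 !scale0r !add0r => E.
  by have := Jl (-1) 0 0; rewrite scaler0 addr0 rmorphN1 scaleN1r addNr.
have JZ c f : J (c *: f) = c^* *: J f by have := Jl c f 0; rewrite J0 !addr0.
have JD f g : J (f + g) = J f + J g.
  by have := Jl 1 f g; rewrite rmorph1 !scale1r.
have JJ f : J (J f) = f.
  apply/eqP; rewrite -subr_eq0 -(dnorm_eq0 dot) -[_ == _]negbK.
  apply/negP => D0; set D := dot _ _ in D0.
  have Dp : 0 < D by rewrite lt_def D0 dnorm_ge0.
  have eps0 : 0 < sqrtC (D / 4) by rewrite sqrtC_gt0 divr_gt0// ltr0n.
  have [h [N [c hE]]] := ce f _ eps0.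
  rewrite ltr_sqrtC ?qualifE/= ?dnorm_ge0 ?ltW ?divr_gt0 ?ltr0n//.
  set x := f - h.
  have JJh : J (J h) = h.
    rewrite hE; elim/big_rec: _ => [|k y _ IH]; first by rewrite !J0.
    by rewrite !JD IH !JZ conjCK Je.
  have fE : J (J f) - f = J (J x) - x.
    by rewrite -[in LHS](subrK h f) -/x !JD JJh opprD addrACA subrr addr0.
  (* by the parallelogram law |J (J x) - x|^2 <= 4 |x|^2, and x was chosen
     with |x|^2 < D / 4 *)
  have par : dot (J (J x) - x) (J (J x) - x) + dot (J (J x) + x) (J (J x) + x) =
             2 * (dot (J (J x)) (J (J x)) + dot x x) by rewrite !dotE; ring.
  have DE : D <= 4 * dot x x.
    rewrite /D fE.
    apply: (@le_trans _ _ (2 * (dot (J (J x)) (J (J x)) + dot x x))).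
      by rewrite -par lerDl dnorm_ge0.
    have -> : 4 * dot x x = 2 * (dot x x + dot x x) by ring.
    by rewrite ler_pM2l ?ltr0n// lerD2r (le_trans (Jc _)).
  rewrite ltr_pdivlMr ?ltr0n// mulrC => lt.
  by have := le_lt_trans DE lt; rewrite ltxx.
split=> // f g; apply: (antilinear_isometry Jl) => {}f.
by apply/le_anti; rewrite Jc/=; have := Jc (J f); rewrite JJ.
Qed.

End InnerProductSpace.

(** * Bilinear forms on polynomials and powers of X - a *)

Section PolynomialForm.
Variables (F : comNzRingType) (B : {poly F} -> {poly F} -> F) (a c : F).
Implicit Types p q : {poly F}.
Hypotheses (BDl : forall b p p' q, B (b *: p + p') q = b * B p q + B p' q)
  (BDr : forall b p q q', B p (b *: q + q') = b * B p q + B p q')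
  (BX : forall j k, B ('X^(j.+1)) ('X^(k.+1)) =
    a * (B ('X^j) ('X^(k.+1)) + B ('X^(j.+1)) ('X^k)) - c * B ('X^j) ('X^k))
  (BX0 : forall j, B ('X^(j.+1)) ('X^0) = a * B ('X^j) ('X^0))
  (B0X : forall k, B ('X^0) ('X^(k.+1)) = a * B ('X^0) ('X^k)).

(** Linear identities between polynomials need only be checked on monomials. *)
Lemma poly_linear_eq0 (L : {poly F} -> F) :
  (forall b p q, L (b *: p + q) = b * L p + L q) ->
  (forall k, L 'X^k = 0) -> forall p, L p = 0.
Proof.
move=> Ll LX p.
have L0 : L 0 = 0 by have := Ll (-1) 0 0; rewrite scaler0 addr0 mulN1r addNr.
rewrite -[p]coefK poly_def; elim/big_rec: _ => // i x _ IH.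
by rewrite Ll LX IH mulr0 addr0.
Qed.

(** The recurrence extends to B (X p) (X q) by bilinearity; expanding the
    products, its mixed terms cancel because X is shifted by the same a. *)
Lemma form_mul_XsubC p q :
  B (('X - a%:P) * p) (('X - a%:P) * q) = (a ^+ 2 - c) * B p q.
Proof.
have E r : ('X - a%:P) * r = (- a) *: r + 'X * r.
  by rewrite mulrBl mul_polyC scaleNr addrC.
have XE (b : F) (r r' : {poly F}) :
    'X * (b *: r + r') = b *: ('X * r) + 'X * r'.
  by rewrite mulrDr -scalerAr.
rewrite !E !BDl !BDr; apply/eqP; rewrite -subr_eq0; apply/eqP.
move: p; apply: poly_linear_eq0 => [b p p'|j].
  by rewrite XE !BDl; ring.
move: q; apply: poly_linear_eq0 => [b q q'|k].
  by rewrite XE !BDr; ring.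
by rewrite -!exprS BX; ring.
Qed.

Lemma form_XsubC_l1 p : B (('X - a%:P) * p) 1 = 0.
Proof.
rewrite mulrBl mul_polyC addrC -scaleNr BDl.
move: p; apply: poly_linear_eq0 => [b p p'|j].
  by rewrite mulrDr -scalerAr !BDl; ring.
by rewrite -exprS -(expr0 'X) BX0; ring.
Qed.

Lemma form_XsubC_1r q : B 1 (('X - a%:P) * q) = 0.
Proof.
rewrite mulrBl mul_polyC addrC -scaleNr BDr.
move: q; apply: poly_linear_eq0 => [b q q'|k].
  by rewrite mulrDr -scalerAr !BDr; ring.
by rewrite -exprS -(expr0 'X) B0X; ring.
Qed.

Lemma form_XsubC_powers n m : n <> m ->
  B (('X - a%:P) ^+ n) (('X - a%:P) ^+ m) = 0.
Proof.
elim: n m => [|n IHn] [|m] nm //.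
- by rewrite expr0 exprS form_XsubC_1r.
- by rewrite expr0 exprS form_XsubC_l1.
- rewrite !exprS form_mul_XsubC IHn ?mulr0// => nm'.
  by case: nm; rewrite nm'.
Qed.

End PolynomialForm.

Local Open Scope classical_set_scope.
Local Open Scope complex_scope.

(** * The Hardy space in Taylor coefficients *)

Section HardySpace.
Variable R : realType.
Local Notation K := (R[i]).
Implicit Types (c d : nat -> K) (f g : H2 R) (p q : {poly K}).

Lemma square_summableP c (M : K) :
  (forall N, \sum_(k < N) `|c k| ^+ 2 <= M) -> square_summable c.
Proof.
move=> cM; rewrite /square_summable.
apply: (@le_lt_trans _ _ (complex.Re M)%:E); last exact: ltry.
apply: lime_le.
  by apply: is_cvg_nneseries => n _ _; rewrite lee_fin sqr_ge0.
apply: nearW => N; rewrite sumEFin lee_fin big_mkord.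
have := cM N.
under eq_bigr => k _ do rewrite norm_normc -rmorphXn/=.
by rewrite -rmorph_sum/= lecE/= => /andP[_].
Qed.

Lemma geometric_sum_le (b z : K) N : `|z| < 1 ->
  \sum_(k < N) `|b * z ^+ k| ^+ 2 <= `|b| ^+ 2 / (1 - `|z| ^+ 2).
Proof.
move=> z1; have z2 : 0 < 1 - `|z| ^+ 2 by rewrite subr_gt0 expr_lt1.
under eq_bigr => k _ do rewrite normrM exprMn normrX exprAC.
rewrite -mulr_sumr ler_wpM2l ?exprn_ge0// -[leRHS]mul1r ler_pdivlMr//.
have -> : (\sum_(k < N) (`|z| ^+ 2) ^+ k) * (1 - `|z| ^+ 2) =
          1 - (`|z| ^+ 2) ^+ N.
  by rewrite -[RHS](opprB _ 1) subrX1; ring.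
by rewrite gerBl exprn_ge0// exprn_ge0.
Qed.

Lemma square_summable_geometric (b z : K) : `|z| < 1 ->
  square_summable (fun n => b * z ^+ n).
Proof.
by move=> z1; apply: square_summableP => N; exact: geometric_sum_le.
Qed.

Lemma taylor_expansion_lim c : square_summable c ->
  taylor_expansion c
    (fun z => limn (series (fun n => c n * sval z ^+ n : K^o))).
Proof.
move=> sc z; have := @cvg_h2dot _ c (fun n => (1 * ((sval z)^*)%R ^+ n)) sc.
have -> : (fun n => c n * ((1 * ((sval z)^*)%R ^+ n)^*)%R) =
          (fun n => c n * sval z ^+ n).
  by apply/funext => n; rewrite mul1r rmorphXn/= conjCK.
apply; apply: square_summable_geometric; rewrite norm_conjC; exact: svalP z.
Qed.

Lemma coef_hardy2 c : square_summable c ->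
  (fun z : disk R => limn (series (fun n => c n * sval z ^+ n : K^o)))
    \in @hardy2 R.
Proof.
by move=> sc; apply/mem_set; exists c => //; exact: taylor_expansion_lim.
Qed.

(** Together with [H2coef], this identifies the Hardy space with the space of
    square summable sequences, in which all later computations take place. *)
Definition H2_of_coef c (sc : square_summable c) : H2 R :=
  mkH2 (coef_hardy2 sc).

Lemma H2_of_coefK c (sc : square_summable c) : H2coef (H2_of_coef sc) =1 c.
Proof. by apply: H2coef_unique => //; exact: taylor_expansion_lim. Qed.

Lemma H2_ext f g : H2coef f =1 H2coef g -> f = g.
Proof.
move=> /funext fg; apply/val_inj/funext => z /=.
have [_ /(_ z) tf] := H2coefP f; have [_ /(_ z) tg] := H2coefP g.
rewrite fg in tf; exact: (@cvg_unique _ (@norm_hausdorff _ _) _ _ _ _ tf tg).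
Qed.

Lemma H2coef0 n : H2coef (0 : H2 R) n = 0.
Proof.
have := H2coefD 0 (0 : H2 R) 0 n; rewrite mul0r scale0r add0r add0r => E.
have := H2coefD (-1) (0 : H2 R) 0 n; rewrite scaler0 addr0.
by rewrite mulN1r addNr.
Qed.

Lemma H2coefZ (b : K) f n : H2coef (b *: f) n = b * H2coef f n.
Proof. by rewrite -[b *: f]addr0 H2coefD H2coef0 addr0. Qed.

Lemma H2coef_add f g n : H2coef (f + g) n = H2coef f n + H2coef g n.
Proof. by rewrite -[f in LHS]scale1r H2coefD mul1r. Qed.

Lemma H2coefB f g n : H2coef (f - g) n = H2coef f n - H2coef g n.
Proof. by rewrite -scaleN1r H2coef_add H2coefZ mulN1r. Qed.

(** Multiplication by z is isometric with range orthogonal to the constants;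
    this turns recurrences between coefficients into relations between inner
    products. *)
Lemma H2dot_tail (f g f' g' : H2 R) :
  (forall k, H2coef f' k.+1 = H2coef f k) ->
  (forall k, H2coef g' k.+1 = H2coef g k) ->
  H2dot f' g' = H2coef f' 0 * (H2coef g' 0)^*%R + H2dot f g.
Proof.
move=> ff gg; apply: H2dot_eq; rewrite -(cvg_shiftn 1) /=.
set u : nat -> K^o := fun n => _.
have -> : u = fun n => (H2coef f' 0 * (H2coef g' 0)^*%R : K^o) +
    series (fun n => H2coef f n * (H2coef g n)^*%R : K^o) n.
  apply/funext => n; rewrite /u /series/= addn1 big_nat_recl//=.
  by congr (_ + _); apply: eq_bigr => k _; rewrite ff gg.
by apply: cvgD; [exact: cvg_cst|exact: cvg_H2dot].
Qed.

Lemma square_summable_poly p : square_summable (fun n => p`_n).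
Proof.
apply: (@square_summableP _ (\sum_(k < size p) `|p`_k| ^+ 2)) => N.
have [Np|pN] := leqP N (size p).
  rewrite -(subnKC Np) big_split_ord/= lerDl.
  by apply: sumr_ge0 => i _; rewrite exprn_ge0.
rewrite -(subnKC (ltnW pN)) big_split_ord/= gerDl big1// => i _.
by rewrite nth_default ?leq_addr// normr0 expr0n.
Qed.

Definition H2_of_poly p : H2 R := mkH2 (poly_hardy2 p).

Lemma H2coef_poly p n : H2coef (H2_of_poly p) n = p`_n.
Proof.
apply: (@H2coef_unique _ _ (fun n => p`_n)); first exact: square_summable_poly.
move=> z; apply: cvg_near_cst; exists (size p) => // N /= hN.
rewrite /series/= horner_coef big_mkord -(subnKC hN) big_split_ord/=.
rewrite [X in _ + X]big1 ?addr0// => i _.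
by rewrite nth_default ?mul0r// leq_addr.
Qed.

Lemma H2_of_polyP (b : K) p q :
  H2_of_poly (b *: p + q) = b *: H2_of_poly p + H2_of_poly q.
Proof.
by apply: H2_ext => n; rewrite H2coefD !H2coef_poly coefD coefZ.
Qed.

Lemma H2_of_poly_sum (N : nat) (b : 'I_N -> K) (p : 'I_N -> {poly K}) :
  H2_of_poly (\sum_k b k *: p k) = \sum_k b k *: H2_of_poly (p k).
Proof.
have p0 : H2_of_poly 0 = 0.
  by apply: H2_ext => n; rewrite H2coef_poly coef0 H2coef0.
elim/big_rec2: _ => // k x y _ <-; exact: H2_of_polyP.
Qed.

Lemma shifted_powerE (a : K) n :
  shifted_power a n = H2_of_poly (('X - a%:P) ^+ n).
Proof. by apply/val_inj/funext => z /=; rewrite !hornerE. Qed.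

Definition monomial n : H2 R := H2_of_poly 'X^n.

Lemma H2dot_monomial f n : H2dot f (monomial n) = H2coef f n.
Proof.
apply: H2dot_eq; apply: cvg_near_cst; exists n.+1 => // N /= hN.
rewrite /series/= big_mkord (bigD1 (Ordinal hN))//= big1 ?addr0.
  by rewrite H2coef_poly coefXn eqxx conjC1 mulr1.
move=> i /eqP/val_eqP/= iN; rewrite H2coef_poly coefXn (negPf iN).
by rewrite conjC0 mulr0.
Qed.

Lemma monomial_orthonormal : orthonormal_seq (@H2dot R) monomial.
Proof.
by move=> n m; rewrite [LHS]H2dot_monomial H2coef_poly coefXn eq_sym.
Qed.

Lemma monomial_approx f (e : K) : 0 < e -> exists N,
  sqrtC (H2dot (f - \sum_(k < N) H2coef f k *: monomial k)
               (f - \sum_(k < N) H2coef f k *: monomial k)) < e.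
Proof.
move=> e0; have e20 : 0 < e ^+ 2 by rewrite exprn_gt0.
have /cvgrPdist_lt/(_ _ e20)[N _ /(_ N (leqnn N))] := @cvg_H2dot R f f.
move=> fN; exists N.
rewrite -(ltr_pXn2r (n := 2))// ?nnegrE ?sqrtC_ge0 ?(ltW e0)//; last first.
  exact: dnorm_ge0.
rewrite sqrtCK; apply: le_lt_trans fN; rewrite le_eqVlt; apply/orP; left.
have fE : series (fun n => H2coef f n * (H2coef f n)^*%R : K^o) N =
          \sum_(k < N) `|H2dot f (monomial k)| ^+ 2.
  rewrite /series/= big_mkord; apply: eq_bigr => k _.
  by rewrite H2dot_monomial normCK.
have -> : \sum_(k < N) H2coef f k *: monomial k =
          \sum_(k < N) H2dot f (monomial k) *: monomial k.
  by apply: eq_bigr => k _; rewrite H2dot_monomial.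
have := dot_sub_proj f N monomial_orthonormal; rewrite /= -fE => E.
by rewrite -E ger0_norm// dnorm_ge0.
Qed.

Lemma H2dotC f g : H2dot f g = ((H2dot g f)^*)%R.
Proof. exact: (dotC (@H2dot R)). Qed.

Lemma H2dotDl f g h : H2dot (f + g) h = H2dot f h + H2dot g h.
Proof. exact: (dotDl (@H2dot R)). Qed.

Lemma H2dotDr f g h : H2dot h (f + g) = H2dot h f + H2dot h g.
Proof. exact: (dotDr (@H2dot R)). Qed.

Lemma H2dotBl f g h : H2dot (f - g) h = H2dot f h - H2dot g h.
Proof. by rewrite H2dotDl; congr (_ + _); exact: (dotNl (@H2dot R)). Qed.

Lemma H2dotBr f g h : H2dot h (f - g) = H2dot h f - H2dot h g.
Proof. by rewrite H2dotDr; congr (_ + _); exact: (dotNr (@H2dot R)). Qed.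

Lemma H2dotZl (b : K) f g : H2dot (b *: f) g = b * H2dot f g.
Proof. exact: (dotZl (@H2dot R)). Qed.

Lemma H2dotZr (b : K) f g : H2dot f (b *: g) = (b^*)%R * H2dot f g.
Proof. exact: (dotZr (@H2dot R)). Qed.

Definition H2dotE := (H2dotBl, H2dotBr, H2dotDl, H2dotDr, H2dotZl, H2dotZr).

(** Otherwise a Taylor polynomial closer to f than
    sqrt (<f, f> - M) would have a square norm greater than M. *)
Lemma H2dot_le_sums f (M : K) :
  (forall N, \sum_(k < N) `|H2coef f k| ^+ 2 <= M) -> H2dot f f <= M.
Proof.
move=> fM; have M0 : 0 <= M by have := fM 0; rewrite big_ord0.
rewrite real_leNgt ?ger0_real//; last exact: dnorm_ge0.
apply/negP => Mf.
have e0 : 0 < sqrtC (H2dot f f - M) by rewrite sqrtC_gt0 subr_gt0.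
have [N] := monomial_approx f e0.
have -> : \sum_(k < N) H2coef f k *: monomial k =
          \sum_(k < N) H2dot f (monomial k) *: monomial k.
  by apply: eq_bigr => k _; rewrite H2dot_monomial.
rewrite ltr_sqrtC ?qualifE/=; last 2 first.
- exact: dnorm_ge0.
- by rewrite subr_ge0 ltW.
rewrite (dot_sub_proj f N monomial_orthonormal) ltrD2l ltrN2.
under eq_bigr => k _ do rewrite [X in `|X|]H2dot_monomial.
by move=> /lt_le_trans/(_ (fM N)); rewrite ltxx.
Qed.

(** Taylor's formula at a: p is q (z - a) with q = p (z + a). *)
Lemma lin_span_shifted_power (a : K) p :
  lin_span (shifted_power a) (H2_of_poly p).
Proof.
pose q := p \Po ('X + a%:P).
exists (size q), (fun i => q`_i).
under eq_bigr => i _ do rewrite shifted_powerE.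
rewrite -H2_of_poly_sum -comp_polyE -comp_polyA.
by rewrite comp_polyD comp_polyX comp_polyC subrK comp_polyXr.
Qed.

Lemma complete_shifted_power (a : K) :
  complete_seq (@H2dot R) (shifted_power a).
Proof.
move=> f e /(monomial_approx f)[N fN].
exists (\sum_(k < N) H2coef f k *: monomial k) => //.
rewrite -H2_of_poly_sum; exact: lin_span_shifted_power.
Qed.

Lemma complete_monomial : complete_seq (@H2dot R) monomial.
Proof.
suff -> : monomial = shifted_power 0 by exact: complete_shifted_power.
by apply/funext => n; rewrite shifted_powerE subr0.
Qed.

End HardySpace.

(** * The conjugation attached to a point of the disk *)

Section Conjugation.
Variables (R : realType) (a w : R[i]).
Local Notation K := (R[i]).
Implicit Types (f g : H2 R) (p q : {poly K}).
Hypotheses (a1 : `|a| < 1) (w1 : `|w| = 1) (wa : w * a = (a^*)%R).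
Local Notation abar := (a^*)%R.
Local Notation gam := (sqrtC (1 - `|a| ^+ 2)).

(** The coefficients of psi v, where psi(z) = w (a - z) / (1 - abar z) and v is
    given by its coefficients: (1 - abar z) (psi v) = (abar - w z) v. *)
Fixpoint next_row (v : nat -> K) (k : nat) : K :=
  if k is k'.+1 then abar * (next_row v k' + v k'.+1) - w * v k'
  else abar * v 0.

(** The coefficient of z^k in gam psi(z)^n / (1 - abar z). *)
Fixpoint conj_coef (n : nat) : nat -> K :=
  if n is n'.+1 then next_row (conj_coef n') else fun k => gam * abar ^+ k.

Lemma conj_coef_rec n k :
  conj_coef n.+1 k.+1 =
  abar * (conj_coef n.+1 k + conj_coef n k.+1) - w * conj_coef n k.
Proof. by []. Qed.

Lemma conj_coef_sym n k : conj_coef n k = conj_coef k n.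
Proof.
have conj_coef0 m : conj_coef m 0 = conj_coef 0 m.
  by elim: m => [//|m IH]; rewrite [LHS]/= IH /= [abar ^+ m.+1]exprS mulrCA.
elim: n k => [|n IHn] [|k]; rewrite ?conj_coef0//.
elim: k => [|k IHk].
  by rewrite !conj_coef_rec !conj_coef0 IHn [X in abar * X]addrC.
by rewrite conj_coef_rec [RHS]conj_coef_rec IHk !IHn [X in abar * X]addrC.
Qed.

Lemma normw : w * (w^*)%R = 1.
Proof. by rewrite -normCK w1 expr1n. Qed.

Lemma conj_w_abar : (w^*)%R * abar = a.
Proof. by rewrite -[RHS]conjCK -[in RHS]wa rmorphM. Qed.

Lemma a2_gt0 : 0 < 1 - `|a| ^+ 2.
Proof. by rewrite subr_gt0 expr_lt1. Qed.

(** A quantitative form of the fact that multiplication by psi is isometric.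
    With F the next row, the recurrence reads
    abar v_(N+1) - F_(N+1) = w v_N - abar F_N, and
    |w v_N - abar F_N|^2 - |abar v_N - F_N|^2
    = (1 - |a|^2) (|v_N|^2 - |F_N|^2), so that the sum telescopes. *)
Lemma next_row_sum (v : nat -> K) N :
  (1 - `|a| ^+ 2) * \sum_(k < N) (`|v k| ^+ 2 - `|next_row v k| ^+ 2) =
  `|abar * v N - next_row v N| ^+ 2.
Proof.
elim: N => [|N IH]; first by rewrite big_ord0 mulr0 subrr normr0 expr0n.
rewrite big_ord_recr mulrDr/= IH.
have -> : abar * v N.+1 - (abar * (next_row v N + v N.+1) - w * v N) =
          w * v N - abar * next_row v N by ring.
rewrite !normCK !rmorphB !rmorphM/= conjCK.
set B := next_row v N; set A := v N.
rewrite -[in w * A]/(w * A).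
move: normw conj_w_abar wa.
set w' := (w^*)%R; set A' := (A^*)%R; set B' := (B^*)%R; set a' := abar.
move=> e1 e2 e3.
transitivity (a' * a * A * A' + B * B' - a' * A * B' - B * a * A' +
  (1 - a * a') * (A * A' - B * B')); first by ring.
transitivity ((w * w') * A * A' - (w * a) * A * B' - (w' * a') * B * A' +
  a' * a * B * B').
  by rewrite e1 e2 e3; ring.
by ring.
Qed.

(** By [next_row_sum] the partial sums of squares decrease from one row to
    the next, and row 0 is geometric. *)
Lemma square_summable_conj_coef n : square_summable (conj_coef n).
Proof.
apply: (@square_summableP _ _ (`|gam| ^+ 2 / (1 - `|abar| ^+ 2))) => N.
elim: n => [|n IHn]; first by apply: geometric_sum_le; rewrite norm_conjC.
apply: le_trans IHn; rewrite -subr_ge0 -sumrB -(pmulr_rge0 _ a2_gt0).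
by rewrite next_row_sum exprn_ge0.
Qed.

(** This will be the image of z^n under the conjugation. *)
Definition conj_monomial n : H2 R := H2_of_coef (square_summable_conj_coef n).

Lemma conj_monomial_coef n k : H2coef (conj_monomial n) k = conj_coef n k.
Proof. exact: H2_of_coefK. Qed.

Lemma gam_norm : gam * (gam^*)%R = 1 - `|a| ^+ 2.
Proof.
by rewrite -normCK ger0_norm ?sqrtCK// sqrtC_ge0 ltW// a2_gt0.
Qed.

(** The shift relation u_0 = gam + abar z u_0 gives
    |u_0|^2 = (1 - |a|^2) + |a|^2 |u_0|^2. *)
Lemma conj_monomial00 : H2dot (conj_monomial 0) (conj_monomial 0) = 1.
Proof.
have T k : H2coef (conj_monomial 0) k.+1 = H2coef (abar *: conj_monomial 0) k.
  by rewrite H2coefZ !conj_monomial_coef /= [abar ^+ k.+1]exprS mulrCA.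
have := H2dot_tail T T.
rewrite !H2dotE conjCK conj_monomial_coef /= expr0 mulr1 gam_norm => E.
apply: (mulfI (lt0r_neq0 a2_gt0)); rewrite mulr1 mulrBl mul1r {1}E.
by rewrite normCK; ring.
Qed.

(** Compare z (abar u_(n+1) - w u_n) = u_(n+1) - abar u_n, the recurrence,
    with z (abar u_0) = u_0 - gam: the terms in u_n cancel as w a = abar. *)
Lemma conj_monomialS0 n : H2dot (conj_monomial n.+1) (conj_monomial 0) = 0.
Proof.
have T k : H2coef (conj_monomial 0) k.+1 = H2coef (abar *: conj_monomial 0) k.
  by rewrite H2coefZ !conj_monomial_coef /= [abar ^+ k.+1]exprS mulrCA.
have T' k : H2coef (conj_monomial n.+1 - abar *: conj_monomial n) k.+1 =
            H2coef (abar *: conj_monomial n.+1 - w *: conj_monomial n) k.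
  by rewrite !H2coefB !H2coefZ !conj_monomial_coef conj_coef_rec; ring.
have := H2dot_tail T' T.
rewrite H2coefB H2coefZ !conj_monomial_coef subrr mul0r add0r !H2dotE conjCK.
move: (H2dot _ _) (H2dot _ _) => A B E.
apply: (mulfI (lt0r_neq0 a2_gt0)); rewrite mulr0 normCK.
have -> : (1 - a * abar) * B = B - (w * a) * A - (abar * (a * B) - (w * a) * A).
  by rewrite wa; ring.
by rewrite {1}wa E; ring.
Qed.

(** With x_n = abar u_n - u_(n+1) and y_n = w u_n - abar u_(n+1) the recurrence
    says x_n = z y_n, so <x_n, x_m> = <y_n, y_m>.  The mixed products agree on
    both sides since w a = abar, and a factor 1 - |a|^2 is left. *)
Lemma conj_monomialSS n m :
  H2dot (conj_monomial n.+1) (conj_monomial m.+1) =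
  H2dot (conj_monomial n) (conj_monomial m).
Proof.
pose x n := abar *: conj_monomial n - conj_monomial n.+1.
pose y n := w *: conj_monomial n - abar *: conj_monomial n.+1.
have T i k : H2coef (x i) k.+1 = H2coef (y i) k.
  by rewrite !H2coefB !H2coefZ !conj_monomial_coef conj_coef_rec; ring.
have x0 i : H2coef (x i) 0 = 0.
  by rewrite H2coefB H2coefZ !conj_monomial_coef subrr.
have := H2dot_tail (T n) (T m); rewrite x0 mul0r add0r /x /y !H2dotE conjCK.
move: (H2dot (conj_monomial n) (conj_monomial m))
  (H2dot (conj_monomial n) (conj_monomial m.+1))
  (H2dot (conj_monomial n.+1) (conj_monomial m))
  (H2dot (conj_monomial n.+1) (conj_monomial m.+1)).
move=> A B C D E.
apply: (mulfI (lt0r_neq0 a2_gt0)); rewrite normCK.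
apply/eqP; rewrite -subr_eq0.
have -> : (1 - a * abar) * D - (1 - a * abar) * A =
    abar * (a * A) - abar * B - (a * C - D) -
    ((w * (w^*)%R) * A - (w * a) * B - ((w^*)%R * abar) * C + abar * a * D).
  by rewrite normw wa conj_w_abar; ring.
by rewrite E subr_eq0; apply/eqP; ring.
Qed.

Lemma conj_monomial_orthonormal : orthonormal_seq (@H2dot R) conj_monomial.
Proof.
elim=> [|n IHn] [|m].
- exact: conj_monomial00.
- by rewrite [LHS]H2dotC conj_monomialS0 conjC0.
- exact: conj_monomialS0.
- by rewrite [LHS]conj_monomialSS; exact: IHn.
Qed.

Lemma square_summable_hardy_conj f :
  square_summable (fun k => H2dot (conj_monomial k) f).
Proof.
apply: (@square_summableP _ _ (H2dot f f)) => N.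
exact: (bessel f N conj_monomial_orthonormal).
Qed.

(** The definition uses the symmetry of the matrix: the k-th coefficient of J f
    is sum_n U_(n,k) f_n^* = sum_n U_(k,n) f_n^* = <u_k, f>. *)
Definition hardy_conj f : H2 R := H2_of_coef (square_summable_hardy_conj f).

Lemma hardy_conj_coef f k : H2coef (hardy_conj f) k = H2dot (conj_monomial k) f.
Proof. exact: H2_of_coefK. Qed.

Lemma hardy_conjP (b : K) f g :
  hardy_conj (b *: f + g) = (b^*)%R *: hardy_conj f + hardy_conj g.
Proof.
by apply: H2_ext => k; rewrite H2coefD !hardy_conj_coef H2dotDr H2dotZr.
Qed.

Lemma hardy_conj_le f : H2dot (hardy_conj f) (hardy_conj f) <= H2dot f f.
Proof.
apply: H2dot_le_sums => N; under eq_bigr => k _ do rewrite hardy_conj_coef.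
exact: (bessel f N conj_monomial_orthonormal).
Qed.

Lemma hardy_conj_monomial n : hardy_conj (monomial R n) = conj_monomial n.
Proof.
apply: H2_ext => k.
by rewrite hardy_conj_coef H2dot_monomial !conj_monomial_coef conj_coef_sym.
Qed.

Lemma hardy_conj_conj_monomial n : hardy_conj (conj_monomial n) = monomial R n.
Proof.
apply: H2_ext => k; rewrite hardy_conj_coef H2coef_poly coefXn.
exact: conj_monomial_orthonormal.
Qed.

Lemma hardy_conj_conjugation : conjugation (@H2dot R) hardy_conj.
Proof.
apply: (antilinear_contraction_conjugation (@complete_monomial R)).
- exact: hardy_conjP.
- exact: hardy_conj_le.
- by move=> n; rewrite hardy_conj_monomial hardy_conj_conj_monomial.
Qed.

(** Antilinearity of J makes this bilinear, so that identities extend from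
    monomials to polynomials in each argument. *)
Definition hardy_form p q : K :=
  H2dot (H2_of_poly p) (hardy_conj (H2_of_poly q)).

Lemma hardy_formPl (b : K) p p' q :
  hardy_form (b *: p + p') q = b * hardy_form p q + hardy_form p' q.
Proof. by rewrite /hardy_form H2_of_polyP H2dotDl H2dotZl. Qed.

Lemma hardy_formPr (b : K) p q q' :
  hardy_form p (b *: q + q') = b * hardy_form p q + hardy_form p q'.
Proof.
by rewrite /hardy_form H2_of_polyP hardy_conjP H2dotDr H2dotZr conjCK.
Qed.

Lemma hardy_formX j k : hardy_form 'X^j 'X^k = ((conj_coef j k)^*)%R.
Proof.
rewrite /hardy_form hardy_conj_monomial H2dotC H2dot_monomial.
by rewrite conj_monomial_coef conj_coef_sym.
Qed.

Lemma hardy_form_powers n m : n <> m ->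
  hardy_form (('X - a%:P) ^+ n) (('X - a%:P) ^+ m) = 0.
Proof.
apply: (form_XsubC_powers (c := (w^*)%R) hardy_formPl hardy_formPr)
  => [j k|j|k].
- rewrite !hardy_formX conj_coef_rec rmorphB !rmorphM rmorphD/= conjCK.
  by rewrite [X in a * X]addrC.
- rewrite !hardy_formX !(conj_coef_sym _ 0)/= [abar ^+ j.+1]exprS.
  by rewrite !rmorphM/= conjCK mulrCA.
- by rewrite !hardy_formX/= [abar ^+ k.+1]exprS !rmorphM/= conjCK mulrCA.
Qed.

Lemma hardy_conj_shifted_power n m : n <> m ->
  H2dot (hardy_conj (shifted_power a n)) (shifted_power a m) = 0.
Proof.
move=> nm; rewrite H2dotC !shifted_powerE -/(hardy_form _ _).
by rewrite hardy_form_powers ?conjC0// => mn; exact: nm.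
Qed.

End Conjugation.

Theorem theorem1p3 (R : realType) (a : R[i]) (ha : `|a| < 1) :
  [/\ complete_seq (@H2dot R) (shifted_power a),
      conjugate_orthogonal (@H2dot R) (shifted_power a)
    & a <> 0 -> ~ orthonormal_basis (@H2dot R) (shifted_power a)].
Proof.
split; first exact: complete_shifted_power.
- pose w := if a == 0 then 1 else (a^*)%R / a.
  have w1 : `|w| = 1.
    rewrite /w; case: eqVneq => [_|a0]; first by rewrite normr1.
    by rewrite normf_div norm_conjC divff// normr_eq0.
  have wa : w * a = (a^*)%R.
    rewrite /w; case: eqVneq => [->|a0]; first by rewrite mulr0 conjC0.
    by rewrite divfK.
  exists (hardy_conj ha w1 wa); first exact: hardy_conj_conjugation.
  exact: hardy_conj_shifted_power.
- move=> a0 [/(_ 1 0) + _]; rewrite [X in X = _]/=.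
  rewrite !shifted_powerE expr1 expr0 -(expr0 'X) [LHS]H2dot_monomial.
  rewrite H2coef_poly coefB coefX coefC /= sub0r => /eqP.
  by rewrite oppr_eq0 => /eqP.
Qed.
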